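(* Let $U_4$ be the set of real skew-symmetric $4\times 4$ matrices, and let $F:U_4\to\mathbb{R}$ be a carriage-wise polynomial function that is invariant under cluster mutations, i.e. $F(\mu_k(X))=F(X)$ for all $X\in U_4$ and all $k\in\{1,2,3,4\}$. Then there exists a polynomial $f$ in one variable such that $F(X)=f(\det X)$ for all $X\in U_4$.
   Context: An $n$-quiver is a real skew-symmetric $n\times n$ matrix $X=(x_{i,j})$; $U_n$ denotes the set of all $n$-quivers. A carriage is a subset of $U_n$ consisting of all quivers whose entries $x_{i,j}$ ($i<j$) have prescribed signs (each prescribed to be $\ge 0$ or $\le 0$), so $U_n$ is covered by $2^{\binom n2}$ carriages $S_i$. A function $F:U_n\to\mathbb{R}$ is carriage-wise polynomial if to each carriage $S_i$ there corresponds a polynomial $P_i$ in the entries $x_{1,2},\dots,x_{n-1,n}$ such that $F(X)=P_i(X)$ for all $X\in S_i$. For $k\in\{1,\dots,n\}$ the cluster mutation $\mu_k:U_n\to U_n$ is defined entrywise: $x_{i,j}\mapsto -x_{i,j}$ if $k\in\{i,j\}$; if $k\ne i,j$, then $x_{i,j}\mapsto x_{i,j}+x_{i,k}x_{k,j}$ if $x_{i,k}>0$ and $x_{k,j}>0$, $x_{i,j}\mapsto x_{i,j}-x_{i,k}x_{k,j}$ if $x_{i,k}<0$ and $x_{k,j}<0$, and $x_{i,j}\mapsto x_{i,j}$ otherwise. *)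

(* Defs.v *)
From HB Require Import structures.
From mathcomp Require Import all_boot all_order all_algebra reals.
From mathcomp Require Import mpoly.

Set Implicit Arguments.
Unset Strict Implicit.
Unset Printing Implicit Defensive.

Import Order.TTheory GRing.Theory Num.Theory.
Local Open Scope ring_scope.

(* The proof field is irrelevant, equality on 'M[R]_n being decidable: two
   quivers with the same matrix are equal. *)
Record quiver (R : realType) (n : nat) := Quiver {
  quiver_mx :> 'M[R]_n;
  quiver_skew : quiver_mx^T = - quiver_mx
}.

Lemma quiverC (R : realType) (n : nat) (X : quiver R n) (i j : 'I_n) :
  X j i = - X i j.
Proof. by have /matrixP/(_ i j) := quiver_skew X; rewrite !mxE. Qed.

Section Carriage.
Variables (R : realType) (n : nat).

Definition upper_pair := {p : 'I_n * 'I_n | (p.1 < p.2)%N}.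

Definition upper_entry (X : quiver R n) (p : upper_pair) : R :=
  X (val p).1 (val p).2.

(* [true] encodes the sign >= 0 and [false] the sign <= 0, so that carriages
   overlap where an entry vanishes. *)
Definition carriage (s : {ffun upper_pair -> bool}) (X : quiver R n) : Prop :=
  forall p, if s p then 0 <= upper_entry X p else upper_entry X p <= 0.

Definition eval_quiver (P : {mpoly R[#|{: upper_pair}|]}) (X : quiver R n) : R :=
  P.@[fun k => upper_entry X (enum_val k)].

Definition carriagewise_polynomial (F : quiver R n -> R) : Prop :=
  forall s : {ffun upper_pair -> bool},
  exists P : {mpoly R[#|{: upper_pair}|]},
  forall X, carriage s X -> F X = eval_quiver P X.

End Carriage.

Section Mutation.
Variables (R : realType) (n : nat) (k : 'I_n) (X : quiver R n).

Definition mutation_mx : 'M[R]_n :=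
  \matrix_(i, j)
    if (k == i) || (k == j) then - X i j
    else if (0 < X i k) && (0 < X k j) then X i j + X i k * X k j
    else if (X i k < 0) && (X k j < 0) then X i j - X i k * X k j
    else X i j.

Lemma mutation_skew : mutation_mx^T = - mutation_mx.
Proof.
apply/matrixP => i j; rewrite !mxE orbC.
rewrite (quiverC X i j) (quiverC X k j) (quiverC X i k).
case: ifP => // _; rewrite !oppr_gt0 !oppr_lt0 mulrNN (mulrC (X k j)).
rewrite (andbC (X k j < 0)) (andbC (0 < X k j)).
case: (ltgtP (X i k) 0) => _ /=; case: (ltgtP (X k j) 0) => _ //=.
- by rewrite opprB addrC.
- by rewrite opprD.
Qed.

Definition mutation : quiver R n := Quiver mutation_skew.

End Mutation.

Definition mutation_invariant (R : realType) (n : nat) (F : quiver R n -> R) :=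
  forall (X : quiver R n) (k : 'I_n), F (mutation k X) = F X.

(* Main.v *)
Require Import Defs.
From HB Require Import structures.
From mathcomp Require Import all_boot all_order all_algebra reals.
From mathcomp Require Import ring lra.
From mathcomp Require Import mpoly.

(* On the carriage of a tournament, [F] is a polynomial. If [j -> k -> i], then
   [mutation k] carries a neighbourhood of a suitable point of the wall
   [x_ij = 0] into a single carriage by a polynomial map, so the polynomials on
   both sides of the wall coincide. For four vertices these wall crossings
   connect all 64 tournaments, hence [F] is one polynomial [phi].

   Now the mutation formulas of every sign pattern at [k] apply to [phi] on all
   of the space. Comparing them shows that [phi] is invariant under
   [x_wv |-> x_wv + t x_wk x_kv] for [t = 1], hence for natural [t], hence for
   real [t]. When [x_wk <> 0] this is an arbitrary elementary congruence
   [X |-> E X E^T], and the restriction disappears by density. Therefore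
   [phi X] depends only on the Pfaffian of [X], and mutation at a source shows
   that it is an even function of it. *)

Set Implicit Arguments.
Unset Strict Implicit.
Unset Printing Implicit Defensive.

Import Order.TTheory GRing.Theory Num.Theory.
Local Open Scope ring_scope.

(** * Polynomial functions of one variable and identity principles for them *)

Section PolynomialFunctions.
Variable R : realType.
Implicit Types (f g : R -> R) (p q : {poly R}).

Definition polyfun f := exists p, forall t, f t = p.[t].

Lemma polyfun_cst c : polyfun (fun=> c).
Proof. by exists c%:P => t; rewrite hornerC. Qed.

Lemma polyfun_id : polyfun id.
Proof. by exists 'X => t; rewrite hornerX. Qed.

Lemma polyfunD f g : polyfun f -> polyfun g -> polyfun (fun t => f t + g t).
Proof. by move=> [p fE] [q gE]; exists (p + q) => t; rewrite hornerD fE gE. Qed.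

Lemma polyfunN f : polyfun f -> polyfun (fun t => - f t).
Proof. by move=> [p fE]; exists (- p) => t; rewrite hornerN fE. Qed.

Lemma polyfunB f g : polyfun f -> polyfun g -> polyfun (fun t => f t - g t).
Proof. by move=> pf pg; apply: polyfunD => //; apply: polyfunN. Qed.

Lemma polyfunM f g : polyfun f -> polyfun g -> polyfun (fun t => f t * g t).
Proof. by move=> [p fE] [q gE]; exists (p * q) => t; rewrite hornerM fE gE. Qed.

(** A nonzero difference [p - q] has fewer than [size (p - q)] roots, while [u] supplies that many
    distinct ones. *)
Lemma polyfun_eq_seq f g (u : nat -> R) : polyfun f -> polyfun g ->
  injective u -> (forall n, f (u n) = g (u n)) -> f =1 g.
Proof.
move=> [p fE] [q gE] u_inj fg t; rewrite fE gE; congr (_.[t]).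
apply/eqP; rewrite -subr_eq0; apply/negP => /negP pq_neq0.
have := max_poly_roots (p := p - q) (rs := mkseq u (size (p - q))) pq_neq0.
rewrite size_mkseq ltnn mkseq_uniq// => /(_ _ isT) H.
suff : false by []; apply: H; apply/allP => x /mapP[n _ ->].
by rewrite rootE hornerD hornerN -fE -gE fg subrr.
Qed.

Definition near0r (P : R -> Prop) :=
  exists2 d : R, 0 < d & forall t, 0 < t < d -> P t.

Lemma near0r_forall (T : finType) (P : T -> R -> Prop) :
  (forall i, near0r (P i)) -> near0r (fun t => forall i, P i t).
Proof.
move=> /fin_all_exists2[d d_gt0 dP].
exists (\big[Order.min/1]_i d i); first exact: lt_bigmin.
move=> t /andP[t_gt0 t_lt] i; apply: dP; rewrite t_gt0 (lt_le_trans t_lt)//.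
exact: bigmin_le.
Qed.

Lemma near0r_and (P Q : R -> Prop) :
  near0r P -> near0r Q -> near0r (fun t => P t /\ Q t).
Proof.
move=> [d d0 dP] [e e0 eQ]; exists (Order.min d e); first by rewrite lt_min d0.
by move=> t; rewrite lt_min => /and3P[t0 td te]; split; [apply: dP|apply: eQ];
  rewrite t0.
Qed.

Lemma polyfun_near0r_gt0 f : polyfun f -> 0 < f 0 -> near0r (fun t => 0 < f t).
Proof.
move=> [p fE]; rewrite fE => p0_gt0.
have [q pE] : exists q, p = q * 'X + (p.[0])%:P.
  have /factor_theorem[q qE] : root (p - (p.[0])%:P) 0.
    by rewrite rootE hornerD hornerN hornerC subrr.
  by exists q; rewrite -[X in q * X](subr0 'X) -qE subrK.
have [B BP] := poly_itv_bound q 0 1.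
have B_ge0 : 0 <= B by apply: le_trans (BP 0 _); rewrite ?lexx ?ler01.
(* Since [|q| <= B] on the unit interval, [t (B + 1) < p(0)] gives [t q(t) >= - t B > - p(0)].
   Adding 1 keeps the denominator positive. *)
exists (Order.min 1 (p.[0] / (B + 1))).
  by rewrite lt_min ltr01 divr_gt0// ltr_wpDl.
move=> t; rewrite lt_min => /and3P[t0 t1].
rewrite ltr_pdivlMr; last by rewrite ltr_wpDl.
move=> tB; rewrite fE pE hornerD hornerM hornerX hornerC.
have := BP t; rewrite (ltW t0) (ltW t1) => /(_ isT).
by rewrite ler_norml => /andP[qB _]; nra.
Qed.

Lemma polyfun_near0r_sign f : polyfun f -> f 0 != 0 ->
  near0r (fun t => f t != 0 /\ (0 < f t) = (0 < f 0)).
Proof.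
move=> fpoly; case: (ltgtP (f 0) 0) => // f0 _.
- have [|d d0 dP] := polyfun_near0r_gt0 (polyfunN fpoly).
    by rewrite oppr_gt0.
  exists d => // t /dP; rewrite oppr_gt0 => ft; split; first by rewrite lt_eqF.
  by rewrite lt_gtF.
- have [d d0 dP] := polyfun_near0r_gt0 fpoly f0.
  by exists d => // t /dP ft; split; rewrite ?ft// gt_eqF.
Qed.

Lemma polyfun_eq_near0r f g : polyfun f -> polyfun g ->
  near0r (fun t => f t = g t) -> f =1 g.
Proof.
move=> pf pg [d d0 dP].
(* The denominators start at 2 so that every point lies strictly below [d]. *)
apply: (@polyfun_eq_seq _ _ (fun n => d / n.+2%:R)) => // [m n /= /eqP|n].
  rewrite (inj_eq (mulfI (lt0r_neq0 d0))) (inj_eq invr_inj) eqr_nat.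
  by move=> /eqP[].
apply: dP; rewrite divr_gt0//= ltr_pdivrMr// ltr_pMr// ltr1n//.
Qed.

Lemma polyfun_eq_neq0 f g : polyfun f -> polyfun g ->
  (forall t, t != 0 -> f t = g t) -> f =1 g.
Proof.
move=> pf pg fg; apply: polyfun_eq_near0r => //; exists 1 => // t /andP[t0 _].
by rewrite fg ?gt_eqF.
Qed.

End PolynomialFunctions.

(** * Quivers and polynomial curves of quivers *)

Section Quivers.
Variables (R : realType) (n : nat).
Implicit Types (X Y : quiver R n) (u v i j k w : 'I_n).

Lemma quiver_inj X Y : (forall i j, X i j = Y i j) -> X = Y.
Proof.
case: X Y => [X sX] [Y sY] /= XY; have {XY} : X = Y by apply/matrixP.
by move=> XY; subst Y; congr Quiver; apply: eq_irrelevance.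
Qed.

Lemma quiver_diag X i : X i i = 0.
Proof. by have := quiverC X i i; lra. Qed.

Definition mkquiver (x : 'I_n -> 'I_n -> R)
    (x_skew : forall i j, x j i = - x i j) : quiver R n.
Proof.
by exists (\matrix_(i, j) x i j); apply/matrixP => i j; rewrite !mxE x_skew.
Defined.

Lemma mkquiverE x x_skew i j : @mkquiver x x_skew i j = x i j.
Proof. by rewrite mxE. Qed.

Definition polycurve (X : R -> quiver R n) :=
  forall i j, polyfun (fun t => X t i j).

(** The only trace of polynomiality kept from here on: it reduces every identity principle on the
    space of quivers to one variable. *)
Definition curvepoly (phi : quiver R n -> R) :=
  forall X : R -> quiver R n, polycurve X -> polyfun (fun t => phi (X t)).

Lemma eval_quiver_curvepoly P : curvepoly (@eval_quiver R n P).
Proof.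
move=> X Xpoly.
have /fin_all_exists[p pE] : forall k : 'I_#|{: upper_pair n}|,
    exists p : {poly R}, forall t, upper_entry (X t) (enum_val k) = p.[t].
  by move=> k; apply: Xpoly.
exists (\sum_(m <- msupp P) P@_m *: \prod_i p i ^+ m i) => t.
rewrite /eval_quiver mevalE horner_sum; apply: eq_bigr => m _.
rewrite hornerZ horner_prod; congr (_ * _); apply: eq_bigr => i _.
by rewrite horner_exp pE.
Qed.

Fact line_skew X Y t i j :
  X j i + t * (Y j i - X j i) = - (X i j + t * (Y i j - X i j)).
Proof. by rewrite (quiverC X i j) (quiverC Y i j); ring. Qed.

Definition line X Y t := mkquiver (line_skew X Y t).

Lemma line_polycurve X Y : polycurve (line X Y).
Proof.
move=> i j; have [p pE] : polyfun (fun t => X i j + t * (Y i j - X i j)).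
  apply: polyfunD; first exact: polyfun_cst.
  by apply: polyfunM; [exact: polyfun_id|exact: polyfun_cst].
by exists p => t; rewrite mkquiverE.
Qed.

Lemma line0 X Y : line X Y 0 = X.
Proof. by apply: quiver_inj => i j; rewrite mkquiverE mul0r addr0. Qed.

Lemma line1 X Y : line X Y 1 = Y.
Proof. by apply: quiver_inj => i j; rewrite mkquiverE mul1r addrC subrK. Qed.

(** * Mutation as a shear followed by a sign change at [k] *)

Fact negate_skew k X i j :
  (if (k == j) || (k == i) then - X j i else X j i) =
  - (if (k == i) || (k == j) then - X i j else X i j).
Proof. by rewrite orbC (quiverC X i j); case: ifP. Qed.

Definition negate k X := mkquiver (negate_skew k X).

Fact shear_skew k (th : 'I_n -> R) X i j :
  X j i + (th j - th i) * X j k * X k i =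
  - (X i j + (th i - th j) * X i k * X k j).
Proof. by rewrite (quiverC X i j) (quiverC X k j) (quiverC X i k); ring. Qed.

Definition shear k th X := mkquiver (shear_skew k th X).

(** The difference of the indicators of [x_ik > 0] and [x_jk > 0] is 1 or -1 in the two cases where
    mutation adds or subtracts the product. In the other cases it is 0 or the product vanishes. *)
Lemma mutationE k X :
  mutation k X = negate k (shear k (fun i => (0 < X i k)%R%:R) X).
Proof.
apply: quiver_inj => i j; rewrite mxE !mkquiverE.
case: ifP => [/orP[]/eqP<-|_]; first by rewrite quiver_diag; ring.
  by rewrite quiver_diag; ring.
rewrite (quiverC X k j) oppr_gt0.
case: (ltgtP (X i k) 0) => [||->]; case: (ltgtP (X k j) 0) => [||->] * /=; ring.
Qed.

Lemma shear0 k th X : (forall i, i != k -> th i = 0) -> shear k th X = X.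
Proof.
move=> th0; apply: quiver_inj => i j; rewrite mkquiverE.
have [->|ik] := eqVneq i k; first by rewrite quiver_diag; ring.
have [->|jk] := eqVneq j k; first by rewrite quiver_diag; ring.
by rewrite !th0//; ring.
Qed.

Lemma eq_shear k th th' X :
  (forall i, i != k -> th i = th' i) -> shear k th X = shear k th' X.
Proof.
move=> thE; apply: quiver_inj => i j; rewrite !mkquiverE.
have [->|ik] := eqVneq i k; first by rewrite quiver_diag; ring.
have [->|jk] := eqVneq j k; first by rewrite quiver_diag; ring.
by rewrite !thE.
Qed.

(** A shear fixes the entries at [k], the only ones its increments depend on. *)
Lemma shearD k th th' X :
  shear k th (shear k th' X) = shear k (fun i => th i + th' i) X.
Proof. by apply: quiver_inj => i j; rewrite !mkquiverE !quiver_diag; ring. Qed.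

Lemma negate_polycurve k (X : R -> quiver R n) :
  polycurve X -> polycurve (fun t => negate k (X t)).
Proof.
move=> Xpoly i j; have [p pE] := Xpoly i j.
exists (if (k == i) || (k == j) then - p else p) => t.
by rewrite mkquiverE pE; case: ifP; rewrite ?hornerN.
Qed.

Lemma shear_polycurve k (th : R -> 'I_n -> R) (X : R -> quiver R n) :
  (forall i, polyfun (th^~ i)) -> polycurve X ->
  polycurve (fun t => shear k (th t) (X t)).
Proof.
move=> thpoly Xpoly i j.
have [p pE] : polyfun (fun t => X t i j + (th t i - th t j) * X t i k * X t k j).
  by apply: polyfunD => //; do 2!apply: polyfunM => //; apply: polyfunB.
by exists p => t; rewrite mkquiverE.
Qed.

(** * Transport of carriage polynomials by a mutation *)

Definition generic X := forall i j, i != j -> X i j != 0.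

Definition signs X : {ffun upper_pair n -> bool} :=
  [ffun p => 0 < upper_entry X p].

Lemma signs_carriage X : carriage (signs X) X.
Proof. by move=> p; rewrite ffunE; case: ltP => // /ltW. Qed.

Lemma near0r_signs (X : R -> quiver R n) : polycurve X -> generic (X 0) ->
  near0r (fun t => forall i j, i != j -> (0 < X t i j) = (0 < X 0 i j)).
Proof.
move=> Xpoly X0; apply: near0r_forall => i; apply: near0r_forall => j.
have [->|ij] := eqVneq i j; first by exists 1.
have [d d0 dP] := polyfun_near0r_sign (Xpoly i j) (X0 i j ij).
by exists d => // t /dP[].
Qed.

Lemma eq_signs X Y :
  (forall i j, i != j -> (0 < X i j) = (0 < Y i j)) -> signs X = signs Y.
Proof.
move=> XY; apply/ffunP => -[[i j] /= ij]; rewrite !ffunE /upper_entry /=.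
by apply: XY; rewrite neq_ltn ij.
Qed.

Variable F : quiver R n -> R.
Variable phi : {ffun upper_pair n -> bool} -> quiver R n -> R.
Hypothesis phi_poly : forall s, curvepoly (phi s).
Hypothesis phiP : forall s X, carriage s X -> F X = phi s X.
Hypothesis F_inv : mutation_invariant F.

(** [Y] only selects the sign pattern. Along the line from [Y] to [X] both sides are polynomial in
    the parameter. Near [Y] no sign changes before or after mutation, so there the equation is the
    invariance of [F]; at parameter 1 it is the claim. *)
Lemma phi_mutation k Y X : generic Y -> generic (mutation k Y) ->
  phi (signs Y) X = phi (signs (mutation k Y))
    (negate k (shear k (fun i => (0 < Y i k)%R%:R) X)).
Proof.
move=> gY gkY; set th := fun i => _.
pose Z t := negate k (shear k th (line Y X t)).
have Zpoly : polycurve Z.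
  apply/negate_polycurve/shear_polycurve/line_polycurve => i.
  exact: polyfun_cst.
have Z0 : Z 0 = mutation k Y by rewrite /Z line0 -mutationE.
have := @polyfun_eq_near0r _ _ _ (phi_poly (signs Y) (line_polycurve Y X))
  (phi_poly (signs (mutation k Y)) Zpoly) _ 1.
rewrite /Z line1; apply.
have := near0r_and (near0r_signs (line_polycurve Y X) _) (near0r_signs Zpoly _).
rewrite Z0 line0 => /(_ gY gkY)[d d0 dP]; exists d => // t /dP[sY sZ].
rewrite -(eq_signs sY) -(eq_signs sZ).
rewrite -!phiP; try exact: signs_carriage.
rewrite -(F_inv _ k) mutationE; congr (F (negate k _)).
by apply: eq_shear => i ik; rewrite sY.
Qed.

(** * Wall crossing between tournaments *)

Definition tournament (r : rel 'I_n) := forall u v, u != v -> r v u = ~~ r u v.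

Definition tsigns (r : rel 'I_n) : {ffun upper_pair n -> bool} :=
  [ffun p => r (val p).1 (val p).2].

(* The entries at [k] are [+-1], so a mutation at [k] changes the other entries
   by at most 1: this can reverse the sign of [x_ij = +-1/2] but not that of the
   entries [+-2]. *)
Definition weight k i j u v : R :=
  if (u == k) || (v == k) then 1
  else if (u == i) && (v == j) || (u == j) && (v == i) then 1 / 2 else 2.

Lemma weightC k i j u v : weight k i j v u = weight k i j u v.
Proof.
rewrite /weight (orbC (v == k)) (andbC (v == i)) (andbC (v == j)).
by rewrite (orbC (_ && (v == j))).
Qed.

Lemma weight_gt0 k i j u v : 0 < weight k i j u v.
Proof. by rewrite /weight; case: ifP => _; [|case: ifP => _]; lra. Qed.

Definition arc_sign (r : rel 'I_n) u v : R :=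
  if u == v then 0 else if r u v then 1 else -1.

Fact weighted_skew r k i j : tournament r -> forall u v,
  weight k i j v u * arc_sign r v u = - (weight k i j u v * arc_sign r u v).
Proof.
move=> tr u v; rewrite weightC /arc_sign eq_sym; case: eqVneq => [_|uv].
  by rewrite mulr0 oppr0.
by rewrite (tr _ _ uv); case: (r u v) => /=; ring.
Qed.

Definition weighted r (tr : tournament r) k i j :=
  mkquiver (weighted_skew k i j tr).

Lemma weighted_gt0 r (tr : tournament r) k i j u v : u != v ->
  (0 < weighted tr k i j u v) = r u v.
Proof.
move=> uv; rewrite mkquiverE pmulr_rgt0 ?weight_gt0// /arc_sign (negPf uv).
by case: (r u v); lra.
Qed.

Lemma generic_weighted r (tr : tournament r) k i j : generic (weighted tr k i j).
Proof.
move=> u v uv; rewrite mkquiverE.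
apply: mulf_neq0; first by rewrite gt_eqF// weight_gt0.
by rewrite /arc_sign (negPf uv); case: (r u v); rewrite ?oppr_eq0 oner_eq0.
Qed.

Lemma signs_weighted r (tr : tournament r) k i j :
  signs (weighted tr k i j) = tsigns r.
Proof.
apply/ffunP => -[[u v] /= uv]; rewrite !ffunE /upper_entry /=.
by rewrite weighted_gt0// neq_ltn uv.
Qed.

Lemma mutation_weightedE r (tr : tournament r) k i j u v : u != v ->
  mutation k (weighted tr k i j) u v =
  if (u == k) || (v == k) then - arc_sign r u v
  else weight k i j u v * arc_sign r u v + ((r u k)%:R - (r v k)%:R).
Proof.
move=> uv; rewrite mutationE [in LHS]mkquiverE !(eq_sym k) mkquiverE.
have [->|uk] := eqVneq u k.
  by rewrite quiver_diag mkquiverE /weight eqxx /=; ring.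
have [->|vk] := eqVneq v k.
  by rewrite quiver_diag mkquiverE /weight eqxx !orbT /=; ring.
rewrite !weighted_gt0// !mkquiverE /weight /arc_sign !eqxx !orbT /= (negPf uk).
rewrite (eq_sym k v) (negPf vk) (tr v k vk).
by case: (r u k); case: (r v k) => /=; ring.
Qed.

Lemma generic_mutation_weighted r (tr : tournament r) k i j :
  generic (mutation k (weighted tr k i j)).
Proof.
move=> u v uv; rewrite mutation_weightedE// /weight /arc_sign (negPf uv).
have [_|_] := boolP ((u == k) || (v == k)).
  by case: (r u v); apply/eqP => ?; lra.
by case: ifP => _; case: (r u v); case: (r u k); case: (r v k) => /=;
  apply/eqP => ?; lra.
Qed.

(** For [j -> k -> i] the mutation adds -1 to [x_ij = +-1/2], which becomes negative whatever its
    sign was. *)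
Lemma mutation_weighted_gt0 r (tr : tournament r) k i j u v :
    i != k -> j != k -> r j k -> r k i -> u != v ->
  (0 < mutation k (weighted tr k i j) u v) =
    if (u == k) || (v == k) then r v u
    else if (u == i) && (v == j) then false
    else if (u == j) && (v == i) then true else r u v.
Proof.
move=> ik jk rjk rki uv.
rewrite mutation_weightedE// /weight /arc_sign (negPf uv).
have [_|_] := boolP ((u == k) || (v == k)).
  by rewrite (tr _ _ uv); case: (r u v) => /=; lra.
have rik : r i k = false by rewrite -(negbK (r i k)) -(tr i k ik) rki.
have [/andP[/eqP-> /eqP->]|_] /= := boolP ((u == i) && (v == j)).
  by rewrite rik rjk; case: (r i j) => /=; lra.
have [/andP[/eqP-> /eqP->]|_] /= := boolP ((u == j) && (v == i)).
  by rewrite rik rjk; case: (r j i) => /=; lra.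
by case: (r u v); case: (r u k); case: (r v k) => /=; lra.
Qed.

(** The arcs at [k] agree, so both weighted points undergo the same shear, and the forced sign of
    [x_ij] puts their mutations in one carriage. Hence [phi_mutation] gives both polynomials the
    same expression. *)
Lemma phi_flip r r' k i j : tournament r -> tournament r' ->
    i != k -> j != k -> r j k -> r k i ->
    (forall u v, (u == i) && (v == j) || (u == j) && (v == i) \/ r u v = r' u v) ->
  phi (tsigns r) =1 phi (tsigns r').
Proof.
move=> tr tr' ik jk rjk rki rr' X.
have [ki kj] : k != i /\ k != j by rewrite ![k == _]eq_sym.
have rr'k u : r u k = r' u k.
  by have [|//] := rr' u k; rewrite (negPf ki) (negPf kj) !andbF.
have rr'k' u : r k u = r' k u.
  by have [|//] := rr' k u; rewrite (negPf ki) (negPf kj).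
rewrite -(signs_weighted tr k i j) -(signs_weighted tr' k i j).
have E q (tq : tournament q) := phi_mutation X
  (generic_weighted tq k i j) (@generic_mutation_weighted q tq k i j).
rewrite !E.
congr (phi _ (negate k _)); last first.
  by apply: eq_shear => u uk; rewrite !weighted_gt0// rr'k.
apply: eq_signs => u v uv; rewrite !mutation_weighted_gt0 -?rr'k -?rr'k'//.
case: ifP => [/orP[]/eqP->//|_].
by have [|->//] := rr' u v => /orP[]-> //; case: ifP.
Qed.

Lemma phi_signed_shear k (e : pred 'I_n) s X :
  (forall s s', phi s =1 phi s') ->
  phi s (negate k (shear k (fun i => (e i)%:R) X)) = phi s X.
Proof.
move=> phi_const.
(* A tournament with the prescribed arcs at [k]; the order of the other vertices is an arbitrary
   choice. *)
pose r : rel 'I_n := fun u v =>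
  if v == k then e u else if u == k then ~~ e v else (u < v)%N.
have tr : tournament r.
  move=> u v uv; rewrite /r; have [uk|_] := eqVneq u k; have [vk|_] := eqVneq v k.
  - by rewrite uk vk eqxx in uv.
  - by rewrite negbK.
  - by [].
  - by rewrite -leqNgt ltn_neqAle eq_sym uv.
(* No wall is crossed here: with [i = j = k] the weight 1/2 never occurs. *)
have := phi_mutation X (generic_weighted tr k k k)
  (@generic_mutation_weighted r tr k k k).
rewrite !(phi_const _ s) => ->; congr (phi _ (negate k _)).
by apply: eq_shear => i ik; rewrite weighted_gt0// /r eqxx.
Qed.

End Quivers.

(** * Connectedness of the 64 tournaments on four vertices under wall crossings *)

Section FourVertices.
Variable R : realType.

(* Numbers the pairs [u < v] below 4 in lexicographic order by 0, ..., 5. *)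
Definition pair_index u v := if u == 0%N then v.-1 else (u + v)%N.

Definition tour (b : seq bool) (u v : nat) : bool :=
  if (u < v)%N then nth false b (pair_index u v)
  else (v < u)%N && ~~ nth false b (pair_index v u).

Lemma tournament_tour b : tournament (fun u v : 'I_4 => tour b u v).
Proof.
move=> u v; rewrite /tour; case: (ltngtP u v) => [//||/val_inj->].
  by rewrite negbK.
by rewrite eqxx.
Qed.

(** A computable form of the hypotheses of [phi_flip]; that [k] differs from [i] and [j] follows
    from [tour] being irreflexive. *)
Definition flippable b b' :=
  has (fun i => has (fun j => has (fun k =>
    [&& tour b j k, tour b k i &
        all (fun u => all (fun v =>
           [|| (u == i) && (v == j) || (u == j) && (v == i)
             | tour b u v == tour b' u v]) (iota 0 4)) (iota 0 4)])
  (iota 0 4)) (iota 0 4)) (iota 0 4).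

Definition flips b := [seq b' <- [seq set_nth false b m (~~ nth false b m)
  | m <- iota 0 6] | flippable b b'].

(** Breadth-first search from the tournament whose arcs all point to the smaller vertex. *)
Definition reachable m :=
  iter m (fun l => undup (l ++ flatten (map flips l))) [:: nseq 6 false].

Definition cube :=
  iter 6 (fun l => map (cons true) l ++ map (cons false) l) [:: [::]].

Definition covers_cube (l : seq (seq bool)) := all (fun b => b \in l) cube.

Lemma covers_cubeP l b0 b1 b2 b3 b4 b5 :
  covers_cube l -> [:: b0; b1; b2; b3; b4; b5] \in l.
Proof.
move=> /allP; apply.
by case: b0 b1 b2 b3 b4 b5 => [] [] [] [] [] []; vm_compute.
Qed.

(** A flip changes one bit and the all-true list is six bits away from the start, so fewer than six
    rounds cannot suffice. *)
Lemma reachable_covers_cube : covers_cube (reachable 6).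
Proof. by vm_compute. Qed.

Variable F : quiver R 4 -> R.
Variable phi : {ffun upper_pair 4 -> bool} -> quiver R 4 -> R.
Hypothesis phi_poly : forall s, curvepoly (phi s).
Hypothesis phiP : forall s X, carriage s X -> F X = phi s X.
Hypothesis F_inv : mutation_invariant F.

Lemma phi_flippable b b' : flippable b b' ->
  phi (tsigns (fun u v : 'I_4 => tour b u v)) =1
  phi (tsigns (fun u v : 'I_4 => tour b' u v)).
Proof.
have lt4 m : m \in iota 0 4 -> (m < 4)%N by rewrite mem_iota.
move=> /hasP[i /lt4 i4] /hasP[j /lt4 j4] /hasP[k /lt4 k4].
move=> /and3P[bjk bki /allP bb'].
apply: (@phi_flip _ _ F phi phi_poly phiP F_inv _ _
  (Ordinal k4) (Ordinal i4) (Ordinal j4)) => //; try exact: tournament_tour.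
- by apply/eqP => -[ik]; move: bki; rewrite /tour ik ltnn.
- by apply/eqP => -[jk]; move: bjk; rewrite /tour jk ltnn.
move=> u v; have in4 (w : 'I_4) : val w \in iota 0 4 by rewrite mem_iota ltn_ord.
by have := allP (bb' _ (in4 u)) _ (in4 v); case/orP => [|/eqP]; [left|right].
Qed.

Lemma phi_reachable m b : b \in reachable m ->
  phi (tsigns (fun u v : 'I_4 => tour b u v)) =1
  phi (tsigns (fun u v : 'I_4 => tour (nseq 6 false) u v)).
Proof.
elim: m b => [|m IHm] b; first by rewrite inE => /eqP->.
rewrite [_ \in _]mem_undup mem_cat => /orP[/IHm//|/flattenP[l /mapP[b' b'm ->]]].
by rewrite mem_filter => /andP[/phi_flippable b'b _] X; rewrite -b'b IHm.
Qed.

Lemma phi_const s s' : phi s =1 phi s'.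
Proof.
suff E t : phi t =1 phi (tsigns (fun u v : 'I_4 => tour (nseq 6 false) u v)).
  by move=> X; rewrite !E.
pose p (u v : nat) (u4 : (u < 4)%N) (v4 : (v < 4)%N) (uv : (u < v)%N) :
    upper_pair 4 :=
  exist _ (Ordinal u4, Ordinal v4) uv.
(* The signs are listed in the order of [pair_index]. *)
pose b := [:: t (@p 0 1 isT isT isT); t (@p 0 2 isT isT isT);
  t (@p 0 3 isT isT isT); t (@p 1 2 isT isT isT); t (@p 1 3 isT isT isT);
  t (@p 2 3 isT isT isT)]%N.
suff -> : t = tsigns (fun u v : 'I_4 => tour b u v).
  exact: (phi_reachable (covers_cubeP _ _ _ _ _ _ reachable_covers_cube)).
apply/ffunP => q; rewrite ffunE.
case: q => -[[[|[|[|[|//]]]] ui] [[|[|[|[|//]]]] vi]] //= uv;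
  by rewrite /tour /=; congr (t _); apply: val_inj; congr (_, _); apply: val_inj.
Qed.

End FourVertices.

(** * Invariance under elementary congruences *)

Section Transvections.
Variables (R : realType) (n : nat).
Implicit Types (X Y : quiver R n) (i j k w : 'I_n).

Fact transvection_skew w k (c : R) X i j :
  X j i + c * ((j == w)%:R * X k i + (i == w)%:R * X j k) =
  - (X i j + c * ((i == w)%:R * X k j + (j == w)%:R * X i k)).
Proof. by rewrite (quiverC X i j) (quiverC X i k) (quiverC X k j); ring. Qed.

(* [E *m X *m E^T] for the elementary matrix [E] adding [c] times row [k] to
   row [w]. *)
Definition transvection w k c X := mkquiver (transvection_skew w k c X).

(** The shear changes [x_wj] by its parameter times [x_wk x_kj]; dividing [c] by [x_wk] leaves
    [c x_kj]. *)
Lemma transvection_shear w k c X : w != k -> X w k != 0 ->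
  transvection w k c X = shear k (fun i => c / X w k * (i == w)%:R) X.
Proof.
move=> wk Xwk; apply: quiver_inj => i j; rewrite !mkquiverE.
have [->|iw] := eqVneq i w; have [->|jw] := eqVneq j w; rewrite /=.
- by rewrite (quiverC X w k); ring.
- by field.
- by rewrite (quiverC X w k); field.
- by ring.
Qed.

Fact perturb_skew w k X i j :
  X j i + ((j == w)%:R * (i == k)%:R - (j == k)%:R * (i == w)%:R) =
  - (X i j + ((i == w)%:R * (j == k)%:R - (i == k)%:R * (j == w)%:R)).
Proof. by rewrite (quiverC X i j); ring. Qed.

Definition perturb w k X := mkquiver (perturb_skew w k X).

Lemma line_perturb w k X t : w != k -> line X (perturb w k X) t w k = X w k + t.
Proof.
move=> wk; rewrite !mkquiverE !eqxx (eq_sym k w) (negPf wk) /=; ring.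
Qed.

Variable phi : quiver R n -> R.
Hypothesis phi_poly : curvepoly phi.
Hypothesis phi_signed_shear : forall k (e : pred 'I_n) X,
  phi (negate k (shear k (fun i => (e i)%:R) X)) = phi X.

Lemma phi_negate k X : phi (negate k X) = phi X.
Proof. by rewrite -[RHS](phi_signed_shear k pred0) shear0. Qed.

(** The pattern [pred1 w], with the negation removed, is the case [t = 1]. Iteration gives natural
    [t], and polynomiality in [t] gives the rest. *)
Lemma phi_shear k w t X : phi (shear k (fun i => t * (i == w)%:R) X) = phi X.
Proof.
have shear_poly : polycurve (fun t => shear k (fun i => t * (i == w)%:R) X).
  apply: shear_polycurve => [i|i j]; last exact: polyfun_cst.
  by apply: polyfunM; [exact: polyfun_id|exact: polyfun_cst].
apply: (polyfun_eq_seq (u := fun m => m%:R) (phi_poly shear_poly)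
  (polyfun_cst (phi X))) => [m m' /eqP|m].
  by rewrite eqr_nat => /eqP.
elim: m => [|m IHm]; first by rewrite shear0// => i _; rewrite mul0r.
rewrite -[RHS]IHm -[RHS](phi_signed_shear k (pred1 w)) phi_negate shearD.
by congr phi; apply: eq_shear => i _ /=; rewrite -natr1; ring.
Qed.

Lemma phi_transvection w k c X : w != k -> phi (transvection w k c X) = phi X.
Proof.
move=> wk; have [Xwk|Xwk] := eqVneq (X w k) 0; last first.
  by rewrite transvection_shear// phi_shear.
(* Along this line the [w k] entry equals [t], so the shear argument applies for [t != 0] and
   polynomiality extends the equality to [t = 0]. *)
pose Z := line X (perturb w k X).
have Zpoly : polycurve Z by exact: line_polycurve.
have TZpoly : polycurve (fun t => transvection w k c (Z t)).
  move=> i j; have [p pE] : polyfun (fun t =>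
      Z t i j + c * ((i == w)%:R * Z t k j + (j == w)%:R * Z t i k)).
    apply: polyfunD => //; apply: polyfunM; first exact: polyfun_cst.
    by apply: polyfunD; apply: polyfunM => //; exact: polyfun_cst.
  by exists p => t; rewrite mkquiverE.
have := polyfun_eq_neq0 (phi_poly TZpoly) (phi_poly Zpoly) _ 0.
rewrite /Z line0; apply => t t0.
have Ztwk : Z t w k != 0 by rewrite line_perturb// Xwk add0r.
by rewrite transvection_shear// phi_shear.
Qed.

End Transvections.

(** * Reduction to a normal form determined by the Pfaffian *)

Section Pfaffian.
Variable R : realType.
Implicit Types (X Y : quiver R 4) (t : R).

Let o0 : 'I_4 := @Ordinal 4 0 isT.
Let o1 : 'I_4 := @Ordinal 4 1 isT.
Let o2 : 'I_4 := @Ordinal 4 2 isT.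
Let o3 : 'I_4 := @Ordinal 4 3 isT.

Lemma quiver4_inj X Y :
  X o0 o1 = Y o0 o1 -> X o0 o2 = Y o0 o2 -> X o0 o3 = Y o0 o3 ->
  X o1 o2 = Y o1 o2 -> X o1 o3 = Y o1 o3 -> X o2 o3 = Y o2 o3 -> X = Y.
Proof.
move=> e01 e02 e03 e12 e13 e23.
have upper (i j : 'I_4) : (i < j)%N -> X i j = Y i j.
  move: i j => [[|[|[|[|//]]]] i4] [[|[|[|[|//]]]] j4] //= _;
  by rewrite ?(bool_irrelevance i4 isT) ?(bool_irrelevance j4 isT).
apply: quiver_inj => i j; have [/upper//|ji|/val_inj->] := ltngtP i j.
  by rewrite (quiverC X j i) (quiverC Y j i) upper.
by rewrite !quiver_diag.
Qed.

Definition pfaffian X :=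
  X o0 o1 * X o2 o3 - X o0 o2 * X o1 o3 + X o0 o3 * X o1 o2.

Lemma det_quiver4 X : \det X = pfaffian X ^+ 2.
Proof.
(* Indexing by natural numbers identifies the differently built ordinals that the cofactor
   expansions produce. *)
pose x i j := X (inord i) (inord j).
have XE (i j : 'I_4) : X i j = x i j by rewrite /x !inord_val.
rewrite (expand_det_row _ ord0) !big_ord_recl big_ord0 /cofactor.
rewrite !(expand_det_row _ ord0) !big_ord_recl !big_ord0 /cofactor.
rewrite !(expand_det_row _ ord0) !big_ord_recl !big_ord0 /cofactor.
rewrite !det_mx11 !mxE /pfaffian !XE /= /bump /=.
have xC i j : x j i = - x i j by rewrite /x quiverC.
have xD i : x i i = 0 by rewrite /x quiver_diag.
rewrite !add1n !xD (xC 0%N 1%N) (xC 0%N 2%N) (xC 0%N 3%N) (xC 1%N 2%N).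
by rewrite (xC 1%N 3%N) (xC 2%N 3%N); ring.
Qed.

Fact normal_form_skew t (i j : 'I_4) :
  (j == o0)%:R * (i == o1)%:R - (j == o1)%:R * (i == o0)%:R +
    t * ((j == o2)%:R * (i == o3)%:R - (j == o3)%:R * (i == o2)%:R) =
  - ((i == o0)%:R * (j == o1)%:R - (i == o1)%:R * (j == o0)%:R +
    t * ((i == o2)%:R * (j == o3)%:R - (i == o3)%:R * (j == o2)%:R)).
Proof. by ring. Qed.

Definition normal_form t := mkquiver (normal_form_skew t).

Lemma normal_form_polycurve (f : R -> R) :
  polyfun f -> polycurve (fun t => normal_form (f t)).
Proof.
move=> fpoly i j; have [p pE] : polyfun (fun t =>
    ((i == o0)%:R * (j == o1)%:R - (i == o1)%:R * (j == o0)%:R) +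
    f t * ((i == o2)%:R * (j == o3)%:R - (i == o3)%:R * (j == o2)%:R)).
  apply: polyfunD; first exact: polyfun_cst.
  by apply: polyfunM => //; exact: polyfun_cst.
by exists p => t; rewrite mkquiverE.
Qed.

Lemma pfaffian_polyfun (X : R -> quiver R 4) :
  polycurve X -> polyfun (fun t => pfaffian (X t)).
Proof.
by move=> Xpoly; apply: polyfunD; [apply: polyfunB|]; apply: polyfunM.
Qed.

Variable phi : quiver R 4 -> R.
Hypothesis phi_poly : curvepoly phi.
Hypothesis phi_signed_shear : forall k (e : pred 'I_4) X,
  phi (negate k (shear k (fun i => (e i)%:R) X)) = phi X.

Let phiT := phi_transvection phi_poly phi_signed_shear.

(** With the pivot [x_01 = 1], the four transvections clear [x_02], [x_12], [x_03], [x_13] in turn.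
    What remains at [x_23] is the Pfaffian. *)
Lemma phi_normal_form1 X : X o0 o1 = 1 -> phi X = phi (normal_form (pfaffian X)).
Proof.
move=> X01; rewrite -(@phiT o2 o1 (- X o0 o2))//.
rewrite -(@phiT o2 o0 (X o1 o2))// -(@phiT o3 o1 (- X o0 o3))//.
rewrite -(@phiT o3 o0 (X o1 o3))//; congr phi.
by apply: quiver4_inj; rewrite !mkquiverE /= ?quiver_diag /pfaffian
  ?(quiverC X o0 o1) ?(quiverC X o0 o2) ?(quiverC X o1 o2) ?X01; ring.
Qed.

Lemma phi_normal_form X : phi X = phi (normal_form (pfaffian X)).
Proof.
have generic_case Y : Y o1 o2 != 0 -> phi Y = phi (normal_form (pfaffian Y)).
  (* The transvection by [c] turns [y_01] into [y_01 - c y_12], and this [c] makes it 1. *)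
  move=> Y12; rewrite -(@phiT o0 o2 ((Y o0 o1 - 1) / Y o1 o2))//.
  rewrite phi_normal_form1.
    congr (phi (normal_form _)); rewrite /pfaffian !mkquiverE /= ?quiver_diag.
    by rewrite (quiverC Y o1 o2); field.
  by rewrite !mkquiverE /= (quiverC Y o1 o2); field.
have [X12|] := eqVneq (X o1 o2) 0; last exact: generic_case.
pose Z := line X (perturb o1 o2 X).
have Zpoly : polycurve Z by exact: line_polycurve.
have := polyfun_eq_neq0 (phi_poly Zpoly)
  (phi_poly (normal_form_polycurve (pfaffian_polyfun Zpoly))) _ 0.
rewrite /Z line0; apply => t t0; apply: generic_case.
by rewrite line_perturb// X12 add0r.
Qed.

Lemma phi_det : exists f : {poly R}, forall X, phi X = f.[\det X].
Proof.
have [g gE] := phi_poly (normal_form_polycurve (polyfun_id R)).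
(* Negating at vertex 0 reverses [x_01] and leaves [x_23], so it reverses the Pfaffian. *)
have g_even t : g.[- t] = g.[t].
  rewrite -!gE -(phi_negate phi_signed_shear o0 (normal_form t)).
  rewrite [RHS]phi_normal_form; congr (phi (normal_form _)).
  by rewrite /pfaffian !mkquiverE /=; ring.
exists (even_poly g) => X; rewrite phi_normal_form gE det_quiver4.
move: (pfaffian X) => t.
(* Evenness of [g] cancels the odd term at [t], leaving a polynomial in the squared Pfaffian. *)
have gt u : g.[u] = (even_poly g).[u ^+ 2] + (odd_poly g).[u ^+ 2] * u.
  by rewrite -{1}(poly_even_odd g) hornerD hornerM !horner_comp !hornerXn hornerX.
by have := g_even t; rewrite !gt sqrrN; lra.
Qed.

End Pfaffian.

Theorem theorem1 (R : realType) (F : quiver R 4 -> R)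
    (F_poly : carriagewise_polynomial F)
    (F_inv : mutation_invariant F) :
  exists f : {poly R}, forall X : quiver R 4, F X = f.[\det X].
Proof.
have [P FP] := fin_all_exists F_poly.
pose phi s X := eval_quiver (P s) X.
have phi_poly s : curvepoly (phi s) by exact: eval_quiver_curvepoly.
have phi_const := phi_const phi_poly FP F_inv.
(* Any carriage would do, since [phi s] is the same function for all [s]. *)
pose s0 : {ffun upper_pair 4 -> bool} := [ffun => true].
have [|f fE] := @phi_det _ (phi s0) (phi_poly s0).
  by move=> k e X; exact: (phi_signed_shear phi_poly FP F_inv).
exists f => X; rewrite -fE (FP _ _ (signs_carriage X)).
exact: phi_const.
Qed.
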